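(* Let $k$ be a positive rational with $k<3$ and $\varepsilon$ a positive real with $\varepsilon\ge\frac{1}{k+1}$. If $G$ is a fractionally $k$-colorable graph and $W\subseteq V(G)$ is a set of vertices at pairwise distance at least seven, then every fractional $(k+\varepsilon)$-precoloring of $W$ extends to a fractional $(k+\varepsilon)$-coloring of $G$.
   Context: A fractional $m$-coloring of a graph (real $m>0$) assigns to each vertex a measurable subset of $[0,m)$ of Lebesgue measure one so that adjacent vertices receive disjoint sets; a graph is fractionally $k$-colorable if it has a fractional $k$-coloring. A fractional $m$-precoloring of a vertex set $W$ assigns measurable subsets of $[0,m)$ of measure one to the vertices of $W$; it extends if some fractional $m$-coloring of the whole graph agrees with it on $W$. Graphs are finite. *)

(* Defs.v *)
From mathcomp Require Import all_boot.
From Stdlib Require Import Reals QArith Qreals.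
Set Implicit Arguments. Unset Strict Implicit. Unset Printing Implicit Defensive.

Definition cover_length (A : R -> Prop) (s : R) : Prop :=
  exists a b : nat -> R,
    (forall n, (a n <= b n)%R) /\
    (forall x, A x -> exists n, (a n <= x)%R /\ (x < b n)%R) /\
    infinite_sum (fun n => (b n - a n)%R) s.

Definition outer_measure_is (A : R -> Prop) (r : R) : Prop :=
  (forall s, cover_length A s -> (r <= s)%R) /\
  (forall r', (forall s, cover_length A s -> (r' <= s)%R) -> (r' <= r)%R).

Definition bounded_set (E : R -> Prop) : Prop :=
  exists M : R, forall x, E x -> (Rabs x <= M)%R.

(* Lebesgue measurability (Caratheodory criterion, tested on bounded sets,
   whose outer measures are finite). *)
Definition lebesgue_measurable (A : R -> Prop) : Prop :=
  forall E : R -> Prop, bounded_set E ->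
  forall r r1 r2 : R,
    outer_measure_is E r ->
    outer_measure_is (fun x => E x /\ A x) r1 ->
    outer_measure_is (fun x => E x /\ ~ A x) r2 ->
    r = (r1 + r2)%R.

Definition unit_subset (m : R) (A : R -> Prop) : Prop :=
  (forall x, A x -> (0 <= x)%R /\ (x < m)%R) /\
  lebesgue_measurable A /\ outer_measure_is A 1%R.

Definition simple_graph (V : finType) (e : rel V) : Prop :=
  ssrbool.symmetric e /\ ssrbool.irreflexive e.

Definition frac_coloring (V : finType) (e : rel V) (m : R)
  (c : V -> R -> Prop) : Prop :=
  (forall v, unit_subset m (c v)) /\
  (forall u v, e u v -> forall x, ~ (c u x /\ c v x)).

Definition frac_colorable (V : finType) (e : rel V) (m : R) : Prop :=
  exists c, frac_coloring e m c.

Definition frac_precoloring (V : finType) (W : {set V}) (m : R)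
  (c : V -> R -> Prop) : Prop :=
  forall v, v \in W -> unit_subset m (c v).

Definition precoloring_extends (V : finType) (e : rel V) (W : {set V}) (m : R)
  (c : V -> R -> Prop) : Prop :=
  exists c', frac_coloring e m c' /\
    forall v, v \in W -> forall x, c' v x <-> c v x.

Definition pairwise_dist_ge (V : finType) (e : rel V) (W : {set V}) (d : nat) : Prop :=
  forall u v, u \in W -> v \in W -> u != v ->
  forall p : seq V, path e u p -> last u p = v -> leq d (size p).

(* Main.v *)
Require Import Defs.
From mathcomp Require Import all_boot.
From Stdlib Require Import Reals QArith Qreals Lra.
From Stdlib Require Import Classical ClassicalEpsilon FunctionalExtensionality PropExtensionality.
From mathcomp Require Import ssrnat.
Set Implicit Arguments. Unset Strict Implicit. Unset Printing Implicit Defensive.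

(** Write [p = k + eps]. Give every colour of [0,p) a type, that is, an
    independent set of [G], distributed as in the given fractional
    [k]-colouring and independently of all precoloured sets. Far from [W] a
    vertex [v] uses the set [B v] of colours whose type contains [v], which has
    measure [p / k > 1], so there is room to drop some colours. Around
    [w \in W] with prescribed set [A], put [s = min(1, eps)], let [S] be a
    random part of [A] of measure [s] and [T] a random part of [B w \ A] of
    measure [(1 - s) / k].
    - Distance 3: [B v \ S].
    - Distance 2: [B v \ (S `|` T)] together with the part of [S] whose new
      type contains [v], the new types on [S] being distributed as the old
      types of the colours of [w]; the gain covers the loss because
      [s * k >= 1 - s].
    - Distance 1: [B v \ A] together with [T]. Neighbours of [w] are pairwise
      non-adjacent: a triangle would need three disjoint unit sets in [0,k),
      while [k < 3].
    Distance at least seven keeps these modifications from interacting, since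
    the sets at distance 3 are contained in the sets [B v]. *)

Local Open Scope R_scope.

(** * Lebesgue outer measure and measurable sets *)

Lemma set_ext (T : Type) (A B : T -> Prop) : (forall x, A x <-> B x) -> A = B.
Proof.
by move=> h; apply: functional_extensionality => x; apply: propositional_extensionality.
Qed.

Lemma nonneg_sum_mono (f : nat -> R) (n m : nat) :
  (forall i, 0 <= f i) -> (n <= m)%N -> sum_f_R0 f n <= sum_f_R0 f m.
Proof.
move=> f0 /subnK <-; elim: (m - n)%N => [|i IH]; first by rewrite add0n; lra.
by rewrite addSn /=; have := f0 (i + n).+1; lra.
Qed.

Lemma nonneg_sum_ge_term (f : nat -> R) (n i : nat) :
  (forall i, 0 <= f i) -> (i <= n)%N -> f i <= sum_f_R0 f n.
Proof.
move=> f0 le_in; apply: Rle_trans (nonneg_sum_mono f0 le_in).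
case: i {le_in} => [|i] /=; first lra.
by have := cond_pos_sum f i f0; lra.
Qed.

Lemma nonneg_sum_lim (f : nat -> R) (s : R) :
  (forall i, 0 <= f i) -> (forall n, sum_f_R0 f n <= s) ->
  exists2 l, infinite_sum f l & l <= s.
Proof.
move=> f0 fs.
have grow : Un_growing (sum_f_R0 f) by move=> n /=; have := f0 n.+1; lra.
have bnd : has_ub (sum_f_R0 f) by exists s => x [n ->].
have [l hl] := growing_cv _ grow bnd.
exists l; first by move=> d /hl.
apply: Rnot_lt_le => lt_sl.
have [n hn] := hl (l - s) ltac:(lra).
have := hn n (Nat.le_refl _); have := fs n.
by rewrite /Rdist => ? /Rabs_def2; lra.
Qed.

Lemma infinite_sum_ge (f : nat -> R) (s : R) (n : nat) :
  (forall i, 0 <= f i) -> infinite_sum f s -> sum_f_R0 f n <= s.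
Proof.
move=> f0 hs; apply: (growing_ineq (sum_f_R0 f)); last by move=> d /hs.
by move=> i /=; have := f0 i.+1; lra.
Qed.

(** Bounding the partial sums instead of naming their limit makes the relation monotone in [s] and
    keeps convergence out of the later arguments. *)
Definition interval_cover (A : R -> Prop) (s : R) : Prop :=
  exists a b : nat -> R,
    [/\ forall n, a n <= b n,
        forall x, A x -> exists n, a n <= x /\ x < b n
      & forall n, sum_f_R0 (fun i => b i - a i) n <= s].

Lemma interval_cover_mono (A B : R -> Prop) (s t : R) :
  (forall x, A x -> B x) -> s <= t -> interval_cover B s -> interval_cover A t.
Proof.
move=> AB st [a [b [ab cov le]]]; exists a, b; split=> //; first by move=> x /AB /cov.
by move=> n; have := le n; lra.
Qed.

Lemma interval_cover_itv (u v : R) :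
  u <= v -> interval_cover (fun x => u <= x /\ x < v) (v - u).
Proof.
move=> uv; exists (fun n => if n is O then u else 0), (fun n => if n is O then v else 0).
split; first by case=> [|n]; lra.
  by move=> x hx; exists O.
by elim=> [|n IH] /=; lra.
Qed.

(** A total function that equals the outer measure whenever one exists, in particular on bounded
    sets. *)
Definition mu (A : R -> Prop) : R := epsilon (inhabits 0) (outer_measure_is A).

Lemma outer_measure_unique (A : R -> Prop) (r r' : R) :
  outer_measure_is A r -> outer_measure_is A r' -> r = r'.
Proof. by move=> [h1 h2] [h1' h2']; apply: Rle_antisym; auto. Qed.

Lemma mu_eq (A : R -> Prop) (r : R) : outer_measure_is A r -> mu A = r.
Proof.
move=> h; apply: (outer_measure_unique _ h).
exact: (epsilon_spec _ _ (ex_intro _ r h)).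
Qed.

Lemma bounded_sub (A B : R -> Prop) :
  bounded_set B -> (forall x, A x -> B x) -> bounded_set A.
Proof. by move=> [M hM] AB; exists M => x /AB /hM. Qed.

Lemma bounded_or (A B : R -> Prop) :
  bounded_set A -> bounded_set B -> bounded_set (fun x => A x \/ B x).
Proof.
move=> [M hM] [N hN]; exists (Rmax M N) => x [/hM|/hN] h.
  by apply: Rle_trans h (Rmax_l _ _).
by apply: Rle_trans h (Rmax_r _ _).
Qed.

Lemma bounded_cover (A : R -> Prop) : bounded_set A -> exists s, interval_cover A s.
Proof.
(* A single interval covers: [+ 1] accounts for its open right end, [Rmax] for a negative [M]. *)
move=> [M hM]; exists (Rmax M 0 + 1 - - Rmax M 0); have := Rmax_r M 0 => ?.
apply: interval_cover_mono (Rle_refl _) (@interval_cover_itv (- Rmax M 0) (Rmax M 0 + 1) _); last lra.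
move=> x /hM; have := Rmax_l M 0; have := Rle_abs x; have := Rle_abs (- x).
by rewrite Rabs_Ropp; lra.
Qed.

Lemma cover_lengthE (A : R -> Prop) (s : R) :
  interval_cover A s -> exists2 l, cover_length A l & l <= s.
Proof.
move=> [a [b [ab cov le]]].
have [|l hl ls] := @nonneg_sum_lim (fun i => b i - a i) s _ le.
  by move=> i; have := ab i; lra.
by exists l => //; exists a, b.
Qed.

Lemma interval_coverE (A : R -> Prop) (s : R) :
  cover_length A s -> interval_cover A s.
Proof.
move=> [a [b [ab [cov hs]]]]; exists a, b; split=> // n.
by apply: infinite_sum_ge hs => i; have := ab i; lra.
Qed.

Lemma interval_cover_ge0 (A : R -> Prop) (s : R) : interval_cover A s -> 0 <= s.
Proof. by move=> [a [b [ab _ le]]]; have /= := le O; have := ab O; lra. Qed.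

Lemma mu_outer (A : R -> Prop) : bounded_set A -> outer_measure_is A (mu A).
Proof.
move=> bA; apply: (epsilon_spec (inhabits 0) (outer_measure_is A)).
have [s0 /cover_lengthE [l0 hl0 _]] := bounded_cover bA.
(* The infimum of the covering lengths is obtained as minus the supremum of their negatives. *)
have bnd : bound (fun y => cover_length A (- y)).
  by exists 0 => y /interval_coverE /interval_cover_ge0; lra.
have ne : exists y, cover_length A (- y) by exists (- l0); rewrite Ropp_involutive.
have [m [ub lub]] := completeness _ bnd ne.
exists (- m); split=> [s hs|r' hr'].
  by have := ub (- s); rewrite Ropp_involutive => /(_ hs); lra.
have : m <= - r' by apply: lub => y /hr'; lra.
by lra.
Qed.

Lemma mu_le (A : R -> Prop) (s : R) : bounded_set A -> interval_cover A s -> mu A <= s.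
Proof.
move=> bA /cover_lengthE [l hl ls].
by have [h _] := mu_outer bA; have := h _ hl; lra.
Qed.

Lemma mu_approx (A : R -> Prop) (d : R) :
  bounded_set A -> 0 < d -> interval_cover A (mu A + d).
Proof.
move=> bA d0; have [_ h] := mu_outer bA.
apply: NNPP => no; have : mu A + d <= mu A; last by lra.
apply: h => s hs; apply: Rnot_lt_le => lt; apply: no.
by apply: interval_cover_mono (interval_coverE hs) => //; lra.
Qed.

Lemma mu_ge0 (A : R -> Prop) : bounded_set A -> 0 <= mu A.
Proof.
move=> bA; have [_ h] := mu_outer bA.
by apply: h => s /interval_coverE /interval_cover_ge0.
Qed.

Lemma Rle_add_eps (x y : R) : (forall d, 0 < d -> x <= y + d) -> x <= y.
Proof. by move=> h; apply: Rnot_lt_le => lt; have := h ((x - y) / 2); lra. Qed.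

Lemma mu_mono (A B : R -> Prop) :
  bounded_set B -> (forall x, A x -> B x) -> mu A <= mu B.
Proof.
move=> bB AB; apply: Rle_add_eps => d d0; apply: mu_le (bounded_sub bB AB) _.
exact: interval_cover_mono AB (Rle_refl _) (mu_approx bB d0).
Qed.

Lemma interval_cover_or (A B : R -> Prop) (s t : R) :
  interval_cover A s -> interval_cover B t ->
  interval_cover (fun x => A x \/ B x) (s + t).
Proof.
move=> [a [b [ab covA leA]]] [c [d [cd covB leB]]].
(* The two covers are interleaved: even indices come from the first, odd ones from the second. *)
pose mix (f g : nat -> R) n := if odd n then g n./2 else f n./2.
exists (mix a c), (mix b d); split.
- by move=> n; rewrite /mix; case: odd.
- move=> x [/covA [n hn]|/covB [n hn]].
    by exists n.*2; rewrite /mix odd_double doubleK.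
  by exists n.*2.+1; rewrite /mix /= odd_double /= uphalf_double.
have mix0 i : 0 <= mix b d i - mix a c i.
  by rewrite /mix; case: odd; [have := cd i./2 | have := ab i./2]; lra.
have E n : sum_f_R0 (fun i => mix b d i - mix a c i) n.*2.+1 =
   sum_f_R0 (fun i => b i - a i) n + sum_f_R0 (fun i => d i - c i) n.
  elim: n => [|n IH]; first by rewrite /= /mix /=; lra.
  rewrite doubleS tech5 tech5 IH /= /mix /= !odd_double /= uphalf_double doubleK.
  by lra.
move=> n; have le_n : (n <= n.*2.+1)%N by rewrite -addnn -addnS leq_addr.
by have := nonneg_sum_mono mix0 le_n; rewrite E; have := leA n; have := leB n; lra.
Qed.

Lemma mu_subadd (A B : R -> Prop) : bounded_set A -> bounded_set B ->
  mu (fun x => A x \/ B x) <= mu A + mu B.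
Proof.
move=> bA bB; apply: Rle_add_eps => d d0.
have d2 : 0 < d / 2 by lra.
apply: mu_le; first exact: bounded_or.
have := interval_cover_or (mu_approx bA d2) (mu_approx bB d2).
by apply: interval_cover_mono => //; lra.
Qed.

(* [lebesgue_measurable] unfolds to a product whose quantifiers would become
   implicit arguments. *)
Unset Implicit Arguments.
Lemma lebesgue_measurableP {A : R -> Prop} :
  (forall E, bounded_set E ->
     mu (fun x => E x /\ A x) + mu (fun x => E x /\ ~ A x) <= mu E) ->
  lebesgue_measurable A.
Proof.
move=> h E bE r r1 r2 /mu_eq <- /mu_eq <- /mu_eq <-.
(* The remaining inequality is subadditivity. *)
apply: Rle_antisym (h E bE).
have b1 : bounded_set (fun x => E x /\ A x) by apply: bounded_sub bE _ => x [].
have b2 : bounded_set (fun x => E x /\ ~ A x) by apply: bounded_sub bE _ => x [].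
apply: Rle_trans (mu_subadd b1 b2); apply: mu_mono (bounded_or b1 b2) _ => x Ex.
by case: (classic (A x)); [left | right].
Qed.

Lemma mu_split {A E : R -> Prop} : lebesgue_measurable A -> bounded_set E ->
  mu E = mu (fun x => E x /\ A x) + mu (fun x => E x /\ ~ A x).
Proof.
move=> mA bE; apply: (mA E bE); apply: mu_outer => //.
  by apply: bounded_sub bE _ => x [].
by apply: bounded_sub bE _ => x [].
Qed.

Lemma measurable_not {A : R -> Prop} :
  lebesgue_measurable A -> lebesgue_measurable (fun x => ~ A x).
Proof.
move=> mA; apply: lebesgue_measurableP => E bE; rewrite (mu_split mA bE).
have -> : (fun x => E x /\ ~ ~ A x) = (fun x => E x /\ A x); last lra.
by apply: set_ext => x; have := NNPP (A x); tauto.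
Qed.

Lemma measurable_and {A B : R -> Prop} :
  lebesgue_measurable A -> lebesgue_measurable B ->
  lebesgue_measurable (fun x => A x /\ B x).
Proof.
move=> mA mB; apply: lebesgue_measurableP => E bE.
have b1 : bounded_set (fun x => E x /\ A x) by apply: bounded_sub bE _ => x [].
have b2 : bounded_set (fun x => E x /\ ~ (A x /\ B x)) by apply: bounded_sub bE _ => x [].
rewrite (mu_split mA bE) (mu_split mB b1) (mu_split mA b2) -Rplus_assoc.
apply: Req_le; congr (mu _ + mu _ + mu _); apply: set_ext => x; tauto.
Qed.

Lemma measurable_or {A B : R -> Prop} :
  lebesgue_measurable A -> lebesgue_measurable B ->
  lebesgue_measurable (fun x => A x \/ B x).
Proof.
move=> mA mB; have := measurable_not (measurable_and (measurable_not mA) (measurable_not mB)).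
congr lebesgue_measurable; apply: set_ext => x.
by have := NNPP (A x); have := NNPP (B x); tauto.
Qed.

Lemma measurable_const (P : Prop) : lebesgue_measurable (fun _ => P).
Proof.
have mu0 : mu (fun _ => False) = 0.
  have b0 : bounded_set (fun _ => False) by exists 0.
  apply: Rle_antisym (mu_ge0 b0); apply: mu_le b0 _.
  by apply: interval_cover_mono (interval_cover_itv (Rle_refl 0)) => //; lra.
apply: lebesgue_measurableP => E bE; case: (classic P) => hP.
  have -> : (fun x => E x /\ P) = E by apply: set_ext => x; tauto.
  have -> : (fun x => E x /\ ~ P) = (fun=> False) by apply: set_ext => x; tauto.
  by rewrite mu0; lra.
have -> : (fun x => E x /\ P) = (fun=> False) by apply: set_ext => x; tauto.
have -> : (fun x => E x /\ ~ P) = E by apply: set_ext => x; tauto.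
by rewrite mu0; lra.
Qed.

(** Cutting each interval of a near-optimal cover of [E] at [t] gives covers of both halves of [E]
    whose lengths add up to the original length. *)
Lemma measurable_lt (t : R) : lebesgue_measurable (fun x => x < t).
Proof.
apply: lebesgue_measurableP => E bE; apply: Rle_add_eps => d d0.
have [a [b [ab cov le]]] := mu_approx bE d0.
pose f i := Rmin (b i) t - Rmin (a i) t; pose g i := Rmax (b i) t - Rmax (a i) t.
have fg i : 0 <= f i /\ 0 <= g i /\ f i + g i = b i - a i.
  by rewrite /f /g /Rmin /Rmax; have := ab i; repeat case: Rle_dec => ?; lra.
have f0 i : 0 <= f i by case: (fg i).
have g0 i : 0 <= g i by case: (fg i) => _ [].
have fgS n : sum_f_R0 f n + sum_f_R0 g n = sum_f_R0 (fun i => b i - a i) n.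
  by elim: n => [|n IH] /=; [case: (fg O) | case: (fg n.+1)]; lra.
(* Independent indices allow the two halves to be bounded one after the other: first over [n] with
   [m] fixed, then over [m]. *)
have fgle n m : sum_f_R0 f n + sum_f_R0 g m <= mu E + d.
  have := nonneg_sum_mono f0 (leq_maxl n m); have := nonneg_sum_mono g0 (leq_maxr n m).
  by have := fgS (maxn n m); have := le (maxn n m); lra.
have mu1 m : mu (fun x => E x /\ x < t) <= mu E + d - sum_f_R0 g m.
  apply: mu_le; first by apply: bounded_sub bE _ => x [].
  exists (fun i => Rmin (a i) t), (fun i => Rmin (b i) t); split.
  - by move=> i; have := f0 i; rewrite /f; lra.
  - move=> x [/cov [n hn] xt]; exists n.
    by rewrite /Rmin; repeat case: Rle_dec => ?; lra.
  - by move=> n; have := fgle n m; rewrite -/f; lra.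
suff : mu (fun x => E x /\ ~ x < t) <= mu E + d - mu (fun x => E x /\ x < t) by lra.
apply: mu_le; first by apply: bounded_sub bE _ => x [].
exists (fun i => Rmax (a i) t), (fun i => Rmax (b i) t); split.
- by move=> i; have := g0 i; rewrite /g; lra.
- move=> x [/cov [n hn] xt]; exists n.
  by rewrite /Rmax; repeat case: Rle_dec => ?; lra.
- by move=> n; have := mu1 n; rewrite -/g; lra.
Qed.

Lemma measurable_itv (u v : R) : lebesgue_measurable (fun x => u <= x /\ x < v).
Proof.
have ge_u : lebesgue_measurable (fun x => u <= x).
  have -> : (fun x => u <= x) = (fun x => ~ x < u) by apply: set_ext => x; lra.
  exact (measurable_not (measurable_lt u)).
exact (measurable_and ge_u (measurable_lt v)).
Qed.

Set Implicit Arguments.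

Lemma bounded_itv (u v : R) : bounded_set (fun x => u <= x /\ x < v).
Proof.
exists (Rmax (Rabs u) (Rabs v)) => x [ux xv].
have := Rmax_l (Rabs u) (Rabs v); have := Rmax_r (Rabs u) (Rabs v).
have := Rle_abs (- u); have := Rle_abs v; rewrite Rabs_Ropp.
by move=> *; apply: Rabs_le; lra.
Qed.

(* Half-open intervals make compactness unnecessary: the set of [x] such that
   the cover has length at least [x] to the left of [x] is closed under suprema
   and, below [m], under small steps to the right. *)
Lemma interval_cover_length (m s : R) :
  0 <= m -> interval_cover (fun x => 0 <= x /\ x < m) s -> m <= s.
Proof.
move=> m0 [a [b [ab cov le]]].
pose f x i := Rmin (b i) x - Rmin (a i) x.
have fmono x y i : x <= y -> 0 <= f x i /\ f x i <= f y i /\ f y i <= b i - a i.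
  by rewrite /f /Rmin; have := ab i; repeat case: Rle_dec => ?; lra.
have f0 x i : 0 <= f x i by case: (@fmono x x i) => //; lra.
have Fmono x y n : x <= y -> sum_f_R0 (f x) n <= sum_f_R0 (f y) n.
  by move=> xy; apply: sum_Rle => i _; case: (fmono _ _ i xy); lra.
pose Z x := [/\ 0 <= x, x <= m & forall d, 0 < d -> exists n, x - d <= sum_f_R0 (f x) n].
have Z0 : Z 0 by split=> // [|d d0]; [lra | exists O; have := f0 0 O => /=; lra].
have bZ : bound Z by exists m => x [].
have [x [ub lub]] := completeness Z bZ (ex_intro _ 0 Z0).
have x0 := ub _ Z0.
have xm : x <= m by apply: lub => y [].
have Zx : Z x.
  split=> // d d0; have [z Zz xz] : exists2 z, Z z & x - d / 2 < z.
    apply: NNPP => no; have : x <= x - d / 2; last lra.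
    by apply: lub => z Zz; apply: Rnot_lt_le => ?; apply: no; exists z.
  have [_ _ /(_ (d / 2) ltac:(lra)) [n hn]] := Zz.
  by exists n; have := Fmono _ _ n (ub _ Zz); lra.
have {xm} xm : x = m.
  apply: NNPP => ne; have [j hj] := cov x ltac:(lra).
  pose y := Rmin (b j) m.
  have xy : x < y by rewrite /y /Rmin; case: Rle_dec; lra.
  have : Z y; last by move/ub; lra.
  split; [lra | exact: Rmin_r | move=> d d0].
  have [_ _ /(_ d d0) [n hn]] := Zx; exists (maxn n j).
  have nn := nonneg_sum_mono (f0 x) (leq_maxl n j).
  have step i : 0 <= f y i - f x i by case: (@fmono x y i); lra.
  have := @nonneg_sum_ge_term _ (maxn n j) j step (leq_maxr n j).
  rewrite minus_sum.
  have : f y j - f x j = y - x.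
    have := Rmin_l (b j) m; rewrite -/y => yb.
    by rewrite /f /Rmin; repeat case: Rle_dec => ?; lra.
  by lra.
apply: Rle_add_eps => d d0; have [_ _ /(_ d d0) [n hn]] := Zx.
have : sum_f_R0 (f x) n <= sum_f_R0 (fun i => b i - a i) n.
  by apply: sum_Rle => i _; case: (@fmono x x i); lra.
by have := le n; rewrite -xm; lra.
Qed.

Lemma mu_itv (m : R) : 0 <= m -> mu (fun x => 0 <= x /\ x < m) = m.
Proof.
move=> m0; have bI := bounded_itv 0 m; apply: Rle_antisym.
  by have := mu_le bI (interval_cover_itv m0); lra.
by apply: Rle_add_eps => d d0; apply: interval_cover_length (mu_approx bI d0).
Qed.

(** * Bounded measurable sets: additivity and subsets of prescribed measure *)

Definition bmeas (A : R -> Prop) : Prop := bounded_set A /\ lebesgue_measurable A.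

Lemma bmeas_and (A B : R -> Prop) :
  bmeas A -> lebesgue_measurable B -> bmeas (fun x => A x /\ B x).
Proof.
by move=> [bA mA] mB; split; [apply: bounded_sub bA _ => x [] | apply: measurable_and].
Qed.

Lemma bmeas_diff (A B : R -> Prop) :
  bmeas A -> lebesgue_measurable B -> bmeas (fun x => A x /\ ~ B x).
Proof. by move=> hA mB; exact: (bmeas_and hA (measurable_not mB)). Qed.

Lemma bmeas_or (A B : R -> Prop) : bmeas A -> bmeas B -> bmeas (fun x => A x \/ B x).
Proof. by move=> [bA mA] [bB mB]; split; [apply: bounded_or | apply: measurable_or]. Qed.

Lemma bmeas_itv (u v : R) : bmeas (fun x => u <= x /\ x < v).
Proof. by split; [apply: bounded_itv | apply: measurable_itv]. Qed.

Lemma mu_empty (A : R -> Prop) : (forall x, ~ A x) -> mu A = 0.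
Proof.
move=> h; rewrite -(mu_itv (Rle_refl 0)); congr mu; apply: set_ext => x.
by split=> [/h|] //; lra.
Qed.

Lemma mu_disjoint (A B : R -> Prop) : bmeas A -> bmeas B -> (forall x, ~ (A x /\ B x)) ->
  mu (fun x => A x \/ B x) = mu A + mu B.
Proof.
move=> [bA mA] [bB mB] AB; rewrite (mu_split mA (bounded_or bA bB)).
by congr (mu _ + mu _); apply: set_ext => x; have := AB x; tauto.
Qed.

Lemma mu_diff (A B : R -> Prop) : bounded_set A -> lebesgue_measurable B ->
  mu (fun x => A x /\ ~ B x) = mu A - mu (fun x => A x /\ B x).
Proof. by move=> bA mB; rewrite (mu_split mB bA); lra. Qed.

(** The intermediate value theorem applies to the measure of the part of [A] below [t], which is
    1-Lipschitz in [t]. *)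
Lemma subset_of_measure (A : R -> Prop) (z : R) : bmeas A -> 0 <= z -> z <= mu A ->
  exists B, [/\ bmeas B, mu B = z & forall x, B x -> A x].
Proof.
move=> hA z0 zA; have [bA mA] := hA.
pose phi t := mu (fun x => A x /\ x < t) - z.
have bt t : bounded_set (fun x => A x /\ x < t) by apply: bounded_sub bA _ => x [].
have lip s t : s <= t -> phi s <= phi t /\ phi t - phi s <= t - s.
  move=> st; split.
    by have := @mu_mono (fun x => A x /\ x < s) _ (bt t); rewrite /phi => h; apply: Rplus_le_compat_r; apply: h => x []; split=> //; lra.
  have := mu_subadd (bt s) (bounded_itv s t).
  have := mu_le (bounded_itv s t) (interval_cover_itv st).
  have := @mu_mono (fun x => A x /\ x < t) _ (bounded_or (bt s) (bounded_itv s t)).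
  have H : forall x, A x /\ x < t -> A x /\ x < s \/ s <= x /\ x < t.
    by move=> x [Ax xt]; case: (Rlt_le_dec x s); [left | right].
  by move=> /(_ H); rewrite /phi; lra.
have cont : continuity phi.
  move=> x eps eps0; exists eps; split=> // y [_] /=; rewrite /Rdist => /Rabs_def2 [h1 h2].
  apply: Rabs_def1.
    by case: (Rle_lt_dec x y) => [/lip|/Rlt_le /lip]; lra.
  by case: (Rle_lt_dec x y) => [/lip|/Rlt_le /lip]; lra.
have [M hM] := bA.
have lo : phi (- Rabs M - 1) = - z.
  rewrite /phi mu_empty ?Rminus_0_l // => x [/hM] h.
  by have := Rle_abs M; have := Rle_abs (- x); rewrite Rabs_Ropp; lra.
have hi : phi (Rabs M + 1) = mu A - z.
  rewrite /phi; congr (mu _ - z); apply: set_ext => x; split=> [[]//|Ax]; split=> //.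
  by have := hM _ Ax; have := Rle_abs M; have := Rle_abs x; lra.
have [||t [_ ht]] := IVT_cor phi (- Rabs M - 1) (Rabs M + 1) cont.
- by have := Rabs_pos M; lra.
- by rewrite lo hi; nra.
exists (fun x => A x /\ x < t); split; [| by move: ht; rewrite /phi; lra | by move=> x []].
exact: (bmeas_and hA (measurable_lt t)).
Qed.

Lemma unit_subsetP (m : R) (A : R -> Prop) :
  unit_subset m A <-> [/\ forall x, A x -> 0 <= x /\ x < m, bmeas A & mu A = 1].
Proof.
split=> [[sub [mA hA]]|[sub [bA mA] hA]].
  split=> //; last exact: mu_eq.
  by split=> //; apply: bounded_sub (bounded_itv 0 m) sub.
by split=> //; split=> //; rewrite -hA; apply: mu_outer.
Qed.

(** * Independent copies of finitely valued functions *)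

(** [P] is a finite union of atoms of the algebra generated by the sets [c v]; the induction splits
    it along one [c v] at a time. *)
Lemma measurable_determined (V : eqType) (s : seq V) (c : V -> R -> Prop) (P : R -> Prop) :
  (forall v, v \in s -> lebesgue_measurable (c v)) ->
  (forall x y, (forall v, v \in s -> (c v x <-> c v y)) -> P x -> P y) ->
  lebesgue_measurable P.
Proof.
elim: s P => [|v s IH] P mc det.
  have [[x Px]|no] := classic (exists x, P x).
    have -> : P = (fun=> True) by apply: set_ext => y; split=> // _; apply: det Px.
    exact: measurable_const.
  have -> : P = (fun=> False) by apply: set_ext => y; split=> // Py; apply: no; exists y.
  exact: measurable_const.
have ms u : u \in s -> lebesgue_measurable (c u).
  by move=> us; apply: mc; rewrite in_cons us orbT.
have mv : lebesgue_measurable (c v) by apply: mc; rewrite mem_head.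
(* [P' b] is the trace of [P] where membership in [c v] has truth value [b], saturated so that it
   depends on the remaining sets only. *)
pose P' (b : Prop) x := exists y, [/\ c v y <-> b, forall u, u \in s -> (c u x <-> c u y) & P y].
have mP' b : lebesgue_measurable (P' b).
  apply: IH ms _ => x x' xx' [y [hv hs Py]]; exists y; split=> // u us.
  by rewrite -(xx' u us); apply: hs.
have -> : P = (fun x => c v x /\ P' True x \/ ~ c v x /\ P' False x).
  apply: set_ext => x; split=> [Px|].
    case: (classic (c v x)) => cx; [left | right]; split=> //; exists x; split=> //; tauto.
  case=> -[cx [y [hv hs Py]]]; apply: det Py => u; rewrite in_cons => /orP [/eqP ->|/hs];
    tauto.
apply: measurable_or; apply: measurable_and (mP' _) => //.
exact (measurable_not mv).
Qed.

(** This is measurability of [q] as a discrete random variable on [Q]. *)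
Record fibred (T : Type) (Q : R -> Prop) (q : R -> T) : Prop := Fibred {
  fibre :> forall F : T -> Prop, bmeas (fun x => Q x /\ F (q x))
}.

Lemma fibred_bmeas (T : Type) (Q : R -> Prop) (q : R -> T) : fibred Q q -> bmeas Q.
Proof. by case=> /(_ (fun=> True)); congr bmeas; apply: set_ext => x; tauto. Qed.

Lemma fibred_sub (T : Type) (Q : R -> Prop) (q : R -> T) (D : T -> Prop) :
  fibred Q q -> fibred (fun x => Q x /\ D (q x)) q.
Proof.
move=> fQ; split=> F; have := fQ (fun t => D t /\ F t).
by congr bmeas; apply: set_ext => x; tauto.
Qed.

Lemma mu_fibre_split (T : Type) (Q : R -> Prop) (q : R -> T) (D F : T -> Prop) : fibred Q q ->
  mu (fun x => Q x /\ F (q x)) =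
  mu (fun x => (Q x /\ D (q x)) /\ F (q x)) + mu (fun x => (Q x /\ ~ D (q x)) /\ F (q x)).
Proof.
move=> fQ; rewrite -(mu_disjoint (fibred_sub D fQ F) (fibred_sub (fun t => ~ D t) fQ F)); last by move=> x; tauto.
by congr mu; apply: set_ext => x; have := classic (D (q x)); tauto.
Qed.

(** Values are served one at a time: a piece of [Q] of the right measure is cut off for [a], and the
    rest is treated recursively. Keeping [g] in the range of [q] everywhere later makes every new
    type an independent set. *)
Lemma proportional_copy (T : eqType) (s : seq T) (X Q : R -> Prop) (q : R -> T) (l : R) :
  0 <= l -> bmeas Q -> fibred X q -> (forall x, X x -> q x \in s) -> mu Q = l * mu X ->
  exists g : R -> T, (forall y, exists x, g y = q x) /\
    forall F : T -> Prop, bmeas (fun y => Q y /\ F (g y)) /\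
      mu (fun y => Q y /\ F (g y)) = l * mu (fun x => X x /\ F (q x)).
Proof.
move=> l0; elim: s X Q => [|a s IH] X Q mQ fX Xs muQ.
  have X0 x : ~ X x by move/Xs.
  have Q0 : mu Q = 0 by rewrite muQ (mu_empty X0); lra.
  (* [q 0] is a default in the range of [q], harmless because [Q] is null. *)
  exists (fun=> q 0); split=> [y|F]; first by exists 0.
  rewrite (@mu_empty (fun x => X x /\ F (q x))); last by move=> x [/X0].
  have [Fq|nFq] := classic (F (q 0)).
    have -> : (fun y => Q y /\ F (q 0)) = Q by apply: set_ext => y; tauto.
    by split=> //; lra.
  split; first exact (bmeas_and mQ (measurable_const _)).
  by rewrite mu_empty; [lra | move=> y []].
(* A listed value that [q] never takes is skipped, so that [g] stays in the range of [q]. *)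
have [[xa qxa]|no] := classic (exists x, a = q x); last first.
  apply: IH => // x Xx; have := Xs x Xx; rewrite in_cons => /orP [/eqP qa|//].
  by case: (no); exists x.
have mX := fibred_bmeas fX.
pose X1 x := X x /\ q x = a; pose X2 x := X x /\ q x <> a.
have mX1 : bmeas X1 := fX (fun t => t = a).
have fX2 : fibred X2 q := fibred_sub (fun t => t <> a) fX.
have X1ge0 : 0 <= mu X1 by apply: mu_ge0; case: mX1.
have X1le : mu X1 <= mu X by apply: mu_mono; [case: mX | move=> x []].
have muX : mu X = mu X1 + mu X2.
  rewrite -(mu_disjoint mX1 (fibred_bmeas fX2)); last by move=> x; rewrite /X1 /X2; tauto.
  by congr mu; apply: set_ext => x; rewrite /X1 /X2; have := classic (q x = a); tauto.
have [||Q1 [mQ1 muQ1 Q1Q]] := @subset_of_measure Q (l * mu X1) mQ; [by nra | by rewrite muQ; nra |].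
pose Q2 y := Q y /\ ~ Q1 y.
have mQ2 : bmeas Q2 by apply: bmeas_diff mQ _; case: mQ1.
have muQ2 : mu Q2 = l * mu X2.
  have -> : mu Q2 = mu Q - mu Q1.
    rewrite /Q2 mu_diff; [|by case: mQ|by case: mQ1].
    by congr (_ - mu _); apply: set_ext => x; have := Q1Q x; tauto.
  by rewrite muQ muQ1 muX; lra.
have [|g [gq hg]] := IH X2 Q2 mQ2 fX2 _ muQ2.
  by move=> x [Xx /eqP/negPf qa]; have := Xs x Xx; rewrite in_cons qa.
exists (fun y => if excluded_middle_informative (Q1 y) then a else g y); split=> [y|F].
  by case: (excluded_middle_informative (Q1 y)) => ?; [exists xa | apply: gq].
have [mF muF] := hg F.
have mQ1F : bmeas (fun y => Q1 y /\ F a) := bmeas_and mQ1 (measurable_const _).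
have -> : (fun y => Q y /\ F (if excluded_middle_informative (Q1 y) then a else g y)) =
    (fun y => Q1 y /\ F a \/ Q2 y /\ F (g y)).
  apply: set_ext => y; case: (excluded_middle_informative (Q1 y)) => h.
    by have := Q1Q y h; rewrite /Q2; tauto.
  by rewrite /Q2 /=; tauto.
split; first exact: bmeas_or.
rewrite mu_disjoint //; last by move=> x; rewrite /Q2; tauto.
rewrite muF (mu_fibre_split (fun t => t = a) F fX) /X2.
have -> : (fun x => (X x /\ q x = a) /\ F (q x)) = (fun x => X1 x /\ F a).
  by apply: set_ext => x; split=> -[[Xx qx]]; rewrite ?/X1 qx; tauto.
have [Fa|nFa] := classic (F a).
  have eF (A : R -> Prop) : (fun x => A x /\ F a) = A by apply: set_ext => x; tauto.
  by rewrite !eF muQ1; lra.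
by rewrite !(@mu_empty (fun x => _ x /\ F a)); [lra | move=> ? [] | move=> ? []].
Qed.

(** A proportional copy on each fibre of [J] separately gives [g] the same conditional distribution
    on all fibres, which is independence of [J]. *)
Lemma independent_copy (T T' : finType) (X Q : R -> Prop) (q : R -> T) (J : R -> T') :
  fibred X q -> 0 < mu X -> fibred Q J ->
  exists g : R -> T, (forall y, exists x, g y = q x) /\
    forall (D : T' -> Prop) (F : T -> Prop),
      bmeas (fun y => (Q y /\ D (J y)) /\ F (g y)) /\
      mu (fun y => (Q y /\ D (J y)) /\ F (g y)) =
        mu (fun y => Q y /\ D (J y)) * (mu (fun x => X x /\ F (q x)) / mu X).
Proof.
move=> fX X0; have : forall y, Q y -> J y \in enum T' by move=> y _; rewrite mem_enum.
elim: (enum T') Q => [|a s IH] Q Js fQ.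
  have Q0 y : ~ Q y by move/Js.
  have QE (A B : R -> Prop) : (fun y => (Q y /\ A y) /\ B y) = Q.
    by apply: set_ext => y; have := Q0 y; tauto.
  exists (fun=> q 0); split=> [y|D F]; first by exists 0.
  split; first by rewrite (QE (fun y => D (J y)) (fun=> F (q 0))); apply: fibred_bmeas fQ.
  have -> : mu (fun y => (Q y /\ D (J y)) /\ F (q 0)) = 0.
    by apply: mu_empty => y; have := Q0 y; tauto.
  have -> : mu (fun y => Q y /\ D (J y)) = 0 by apply: mu_empty => y; have := Q0 y; tauto.
  by lra.
pose Q1 y := Q y /\ J y = a; pose Q2 y := Q y /\ J y <> a.
have mQ1 : bmeas Q1 := fQ (fun t => t = a).
have fQ2 : fibred Q2 J := fibred_sub (fun t => t <> a) fQ.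
have [|g2 [g2q hg2]] := IH Q2 _ fQ2.
  by move=> x [Xx /eqP/negPf qa]; have := Js x Xx; rewrite in_cons qa.
(* This factor scales the distribution of [q] on [X] to the fibre [Q1]. *)
have l0 : 0 <= mu Q1 / mu X.
  by apply: Rmult_le_pos; [apply: mu_ge0; case: mQ1 | apply/Rlt_le/Rinv_0_lt_compat].
have [||g1 [g1q hg1]] := proportional_copy (s := enum T) l0 mQ1 fX.
- by move=> x _; rewrite mem_enum.
- by field; lra.
exists (fun y => if J y == a then g1 y else g2 y); split=> [y|D F].
  by case: eqP => _; [apply: g1q | apply: g2q].
have [mF1 muF1] := hg1 F; have [mF2 muF2] := hg2 D F.
have -> : (fun y => (Q y /\ D (J y)) /\ F (if J y == a then g1 y else g2 y)) =
    (fun y => ((Q1 y /\ F (g1 y)) /\ D a) \/ (Q2 y /\ D (J y)) /\ F (g2 y)).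
  apply: set_ext => y; rewrite /Q1 /Q2; case: eqP => [<-|?]; tauto.
have mDF1 : bmeas (fun y => (Q1 y /\ F (g1 y)) /\ D a) := bmeas_and mF1 (measurable_const _).
split; first exact: bmeas_or.
rewrite mu_disjoint //; last by move=> x; rewrite /Q1 /Q2; tauto.
rewrite muF2 (mu_fibre_split (fun t => t = a) D fQ) /Q2.
have -> : (fun x => (Q x /\ J x = a) /\ D (J x)) = (fun x => Q1 x /\ D a).
  by apply: set_ext => x; split=> -[[Xx qx]]; rewrite ?/Q1 qx; tauto.
have [Da|nDa] := classic (D a).
  have eD (A : R -> Prop) : (fun x => A x /\ D a) = A by apply: set_ext => x; tauto.
  by rewrite !eD muF1; field; lra.
by rewrite !(@mu_empty (fun x => _ /\ D a)); [lra | move=> ? [] | move=> ? []].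
Qed.

(** Random thinning at rate [r], independent of [J]: the points are selected by an independent copy
    of a biased coin, the indicator of [[0,r)] on [[0,1)]. *)
Lemma bernoulli_copy (T : finType) (Q : R -> Prop) (J : R -> T) (r : R) :
  0 <= r <= 1 -> fibred Q J ->
  exists S : R -> Prop, (forall y, S y -> Q y) /\
    forall D : T -> Prop, bmeas (fun y => S y /\ D (J y)) /\
      mu (fun y => S y /\ D (J y)) = r * mu (fun y => Q y /\ D (J y)).
Proof.
move=> [r0 r1] fQ; pose X x := 0 <= x /\ x < 1.
pose q x := if Rlt_dec x r then true else false.
have muX : mu X = 1 by apply: mu_itv; lra.
have fX : fibred X q.
  split=> F; apply: bmeas_and (bmeas_itv 0 1) _.
  apply: (@measurable_determined unit [:: tt] (fun _ x => x < r)) => [v _|x y /(_ tt isT)].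
    exact: measurable_lt.
  by rewrite /q /=; case: (Rlt_dec x r) => h; case: (Rlt_dec y r) => h2 //=; tauto.
have [|g [_ hg]] := independent_copy fX _ fQ; first by lra.
exists (fun y => Q y /\ g y = true); split=> [y []//|D].
have -> : (fun y => (Q y /\ g y = true) /\ D (J y)) = (fun y => (Q y /\ D (J y)) /\ g y = true).
  by apply: set_ext => y; tauto.
have [mS ->] := hg D (fun b => b = true); split=> //; rewrite muX.
have -> : (fun x => X x /\ q x = true) = (fun x => 0 <= x /\ x < r).
  by apply: set_ext => x; rewrite /X /q; case: (Rlt_dec x r) => h; split=> [[[? ?] ?]|[? ?]]; repeat split=> //; lra.
by rewrite mu_itv //; field.
Qed.

(** * Recolouring around a precoloured vertex *)

(* The last clause keeps the colour sets of the precoloured vertices intact. *)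
Definition unit_refinement (p : R) (P U : R -> Prop) : Prop :=
  [/\ unit_subset p U, forall x, U x -> P x & unit_subset p P -> U = P].

Lemma unit_refinement_exists (p : R) (P : R -> Prop) :
  (forall x, P x -> 0 <= x /\ x < p) -> bmeas P -> 1 <= mu P ->
  exists U, unit_refinement p P U.
Proof.
move=> sub mP P1; have [hP|nP] := classic (unit_subset p P); first by exists P.
have [|U [mU muU UP]] := subset_of_measure mP _ P1; first lra.
by exists U; split=> //; apply/unit_subsetP; split=> // x /UP /sub.
Qed.

(** This is what the layers use of a walk of length [i] from [w] to [v]; from length two on, nothing
    is asked of [v]. *)
Definition layer_compatible (V : finType) (e : rel V) (w : V) (i : nat) (v : V) : Prop :=
  (i = 0%N -> v = w) /\ (i = 1%N -> e w v).

(** [L i v] is the set offered to [v] at distance [i] from [w]. Adjacent vertices lie in equal or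
    consecutive layers, and edges with both ends at distance three or more are settled by [B]; hence
    the ranges of [i] and [j]. *)
Record recoloring (V : finType) (e : rel V) (p : R) (w : V) (A : R -> Prop)
    (B : V -> R -> Prop) (L : nat -> V -> R -> Prop) : Prop := Recoloring {
  recoloring0 : forall v, L 0%N v = A;
  recoloring3 : forall v y, L 3%N v y -> B v y;
  recoloring_unit : forall i v, (i <= 3)%N -> layer_compatible e w i v ->
    exists U, unit_refinement p (L i v) U;
  recoloring_disjoint : forall i j u v, (i <= 2)%N -> (i <= j <= i.+1)%N ->
    layer_compatible e w i u -> layer_compatible e w j v ->
    e u v -> forall y, ~ (L i u y /\ L j v y)
}.

Lemma no_triangle (V : finType) (e : rel V) (k : R) (X : R -> Prop) (q : R -> {set V}) (u v w : V) :
  (forall v, mu (fun x => X x /\ v \in q x) = 1) ->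
  (forall x u v, e u v -> u \in q x -> v \in q x -> False) ->
  fibred X q -> mu X < 3 -> e w u -> e w v -> e u v -> False.
Proof.
move=> mu1 st fX X3 wu wv uv.
have m z : bmeas (fun x => X x /\ z \in q x) := fX (fun t => z \in t).
have d1 x : ~ ((X x /\ u \in q x) /\ X x /\ v \in q x) by move=> [[_ h1] [_ h2]]; apply: st uv h1 h2.
have d2 x : ~ ((X x /\ w \in q x) /\ (X x /\ u \in q x \/ X x /\ v \in q x)).
  by move=> [[_ h1] [] [_ h2]]; [apply: st wu h1 h2 | apply: st wv h1 h2].
have := mu_disjoint (m w) (bmeas_or (m u) (m v)) d2; rewrite (mu_disjoint (m u) (m v) d1) !mu1.
have bX : bounded_set X by case: (fibred_bmeas fX).
have : mu (fun x => X x /\ w \in q x \/ X x /\ u \in q x \/ X x /\ v \in q x) <= mu X.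
  by apply: mu_mono => // x; tauto.
by lra.
Qed.

(** [q] gives the types of the old colours and [g] those of the new ones. The last two hypotheses
    express that types have the same distribution on all of [Om] and on [A], that is, independently
    of [A]. *)
Lemma recoloring_exists (V : finType) (e : rel V) (k eps : R)
    (X Om A : R -> Prop) (q g : R -> {set V}) (w : V) :
  0 < eps -> 1 <= k -> k < 3 -> 1 / (k + 1) <= eps ->
  ssrbool.symmetric e -> ssrbool.irreflexive e ->
  (forall y, Om y -> 0 <= y /\ y < k + eps) ->
  fibred X q -> mu X = k -> (forall v, mu (fun x => X x /\ v \in q x) = 1) ->
  (forall x u v, e u v -> u \in q x -> v \in q x -> False) ->
  (forall y, exists x, g y = q x) ->
  (forall y, A y -> Om y) -> fibred Om g -> fibred A g ->
  (forall F : {set V} -> Prop,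
     mu (fun y => Om y /\ F (g y)) = (k + eps) * (mu (fun x => X x /\ F (q x)) / k)) ->
  (forall F : {set V} -> Prop,
     mu (fun y => A y /\ F (g y)) = mu (fun x => X x /\ F (q x)) / k) ->
  exists L, recoloring e (k + eps) w A (fun v y => Om y /\ v \in g y) L.
Proof.
move=> eps0 k1 k3 heps esym eirr OmI fX muX mu1 stq gq AOm fOm fA muOm muA.
have heps1 : 1 <= eps * (k + 1).
  have kE : 1 / (k + 1) * (k + 1) = 1 by field; lra.
  by nra.
(* The probability that the type of a random colour satisfies [F]; the measures below are expressed
   through it. *)
pose nu (F : {set V} -> Prop) := mu (fun x => X x /\ F (q x)) / k.
have kV : 0 < / k by apply: Rinv_0_lt_compat; lra.
have nu0 F : 0 <= nu F.
  by apply: Rmult_le_pos; [apply: mu_ge0; case: (fX F) | lra].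
have nu1 v : nu (fun t => v \in t) = 1 / k by rewrite /nu mu1.
have nuT : nu (fun=> True) = 1.
  rewrite /nu; have -> : (fun x => X x /\ True) = X by apply: set_ext => x; tauto.
  by rewrite muX; field; lra.
pose B v y := Om y /\ v \in g y.
have stg y u v : e u v -> B u y -> B v y -> False.
  by move=> uv [_ +] [_]; have [x ->] := gq y; apply: stq.
pose s := Rmin 1 eps.
(* [s <= eps] keeps layer 3 large enough, and [1 <= s * (k + 1)] pays for the removal of [T] in
   layer 2. *)
have [s1 se s0 sk] : [/\ s <= 1, s <= eps, 0 < s & 1 <= s * (k + 1)].
  by rewrite /s; split; rewrite /Rmin; case: Rle_dec => ?; nra.
(* The rate that gives [T] measure [(1 - s) / k], as [C] has measure [(k + eps - 1) / k]. *)
pose t := (1 - s) / (k + eps - 1).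
have tE : t * (k + eps - 1) = 1 - s by rewrite /t; field; lra.
have t01 : 0 <= t <= 1.
  have : 1 - s <= k + eps - 1 by rewrite /s /Rmin; case: Rle_dec => ?; nra.
  by split; nra.
have [S [SA hS]] := bernoulli_copy (conj (Rlt_le _ _ s0) s1) fA.
pose C y := B w y /\ ~ A y.
have mA : bmeas A := fibred_bmeas fA.
(* Events on [C] are differences of events on [Om] and on [A], whose measures are known. *)
have CE (F : {set V} -> Prop) : (fun y => C y /\ F (g y)) =
    (fun y => (Om y /\ (w \in g y /\ F (g y))) /\ ~ (A y /\ (w \in g y /\ F (g y)))).
  by apply: set_ext => y; rewrite /C /B; tauto.
have fC : fibred C g.
  split=> F; rewrite CE; apply: bmeas_diff (fOm (fun t => w \in t /\ F t)) _.
  by case: (fA (fun t => w \in t /\ F t)).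
have muC F : mu (fun y => C y /\ F (g y)) = (k + eps - 1) * nu (fun t => w \in t /\ F t).
  have [_ mAF] := fA (fun t => w \in t /\ F t).
  have [bF _] := fOm (fun t => w \in t /\ F t).
  rewrite CE (mu_diff bF mAF) (muOm (fun t => w \in t /\ F t)).
  have -> : (fun y => (Om y /\ w \in g y /\ F (g y)) /\ A y /\ w \in g y /\ F (g y)) =
      (fun y => A y /\ w \in g y /\ F (g y)).
    by apply: set_ext => y; have := AOm y; tauto.
  by rewrite (muA (fun t => w \in t /\ F t)) -/(nu (fun t => w \in t /\ F t)); lra.
have [T [TC hT]] := bernoulli_copy t01 fC.
have muT F : mu (fun y => T y /\ F (g y)) = (1 - s) * nu (fun t => w \in t /\ F t).
  by case: (hT F) => _ ->; rewrite muC -tE; lra.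
have fS : fibred S g by split=> F; case: (hS F).
have fT : fibred T g by split=> F; case: (hT F).
have mS := fibred_bmeas fS; have mT := fibred_bmeas fT.
have andT (P : R -> Prop) : (fun y => P y /\ True) = P by apply: set_ext => y; tauto.
have muS : mu S = s.
  by have [_] := hS (fun=> True); rewrite (muA (fun=> True)) -/(nu (fun=> True)) nuT andT; lra.
have muT' : mu T = (1 - s) * (1 / k).
  by have := muT (fun=> True); rewrite andT -(nu1 w) => ->; congr (_ * nu _); apply: set_ext => I; tauto.
(* The new types on [S] are distributed as the types of the colours of [w]. Thus the part of [S]
   gained by [v] is proportional to the probability that a type contains both [w] and [v], just like
   the part of [T] lost by [v]. *)
have [|h [hq hh]] := independent_copy (fibred_sub (fun t : {set V} => w \in t) fX) _ fS.
  by rewrite mu1; lra.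
pose H u y := S y /\ u \in h y.
have HE u : H u = (fun y => (S y /\ True) /\ u \in h y).
  by apply: set_ext => y; rewrite /H; tauto.
have mH u : bmeas (H u).
  by rewrite HE; case: (hh (fun=> True) (fun t => u \in t)).
have muH u : mu (H u) = s * k * nu (fun t => w \in t /\ u \in t).
  rewrite HE; case: (hh (fun=> True) (fun t => u \in t)) => _ ->; rewrite andT muS mu1.
  rewrite /nu; have -> : (fun x => (X x /\ w \in q x) /\ u \in q x) =
     (fun x => X x /\ w \in q x /\ u \in q x) by apply: set_ext => x; tauto.
  by field; lra.
have stH y u v : e u v -> H u y -> H v y -> False.
  by move=> uv [_ +] [_]; have [x ->] := hq y; apply: stq.
have muAv v : mu (fun y => A y /\ v \in g y) = 1 / k.
  by rewrite -(nu1 v); apply: (muA (fun t => v \in t)).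
have mB v : bmeas (B v) := fOm (fun t => v \in t).
have muB v : mu (B v) = (k + eps) * (1 / k) by rewrite -(nu1 v) -muOm.
have muBA v : mu (fun y => B v y /\ A y) = 1 / k.
  rewrite -(muAv v); congr mu; apply: set_ext => y; rewrite /B; have := AOm y; tauto.
have muBS v : mu (fun y => B v y /\ S y) = s * (1 / k).
  rewrite -(muAv v); have [_ <-] := hS (fun t => v \in t).
  congr mu; apply: set_ext => y; rewrite /B; have := AOm y; have := SA y; tauto.
pose L3 v y := B v y /\ ~ S y.
have mL3 v : bmeas (L3 v) by apply: bmeas_diff (mB v) _; case: mS.
have muL3 v : mu (L3 v) = (k + eps - s) * (1 / k).
  by rewrite /L3 mu_diff ?muB ?muBS; [lra | case: (mB v) | case: mS].
have L3ge1 v : 1 <= mu (L3 v).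
  have -> : 1 = k * (1 / k) by field; lra.
  by rewrite muL3; apply: Rmult_le_compat_r; lra.
pose L2' v y := L3 v y /\ ~ T y.
have mL2' v : bmeas (L2' v) by apply: bmeas_diff (mL3 v) _; case: mT.
have muL2' v : mu (L2' v) = (k + eps - s) * (1 / k) - (1 - s) * nu (fun t => w \in t /\ v \in t).
  rewrite /L2' mu_diff ?muL3; [|by case: (mL3 v) | by case: mT].
  rewrite -muT; congr (_ - mu _); apply: set_ext => y; rewrite /L3 /B.
  by have := TC y; have := SA y; rewrite /C /B; tauto.
pose L2 v y := L2' v y \/ H v y.
have mL2 v : bmeas (L2 v) by apply: bmeas_or.
(* Removing [T] costs [(1 - s) * n] and [H v] returns [s * k * n], with [n] the probability that a
   type contains both [w] and [v]; what remains is the measure of [L3 v]. *)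
have L2ge1 v : 1 <= mu (L2 v).
  rewrite /L2 mu_disjoint ?muL2' ?muH //; last by move=> y; rewrite /L2' /L3 /H; tauto.
  have := nu0 (fun t => w \in t /\ v \in t); have := L3ge1 v; rewrite muL3.
  by set n := nu _; set m := _ * (1 / k); nra.
pose L1' v y := B v y /\ ~ A y.
have mL1' v : bmeas (L1' v) by apply: bmeas_diff (mB v) _; case: mA.
pose L1 v y := L1' v y \/ T y.
have mL1 v : bmeas (L1 v) by apply: bmeas_or.
(* [T] lies in [B w], which is disjoint from [B v], so the total is
   [(k + eps - 1) / k + (1 - s) / k], the measure of [L3 v]. *)
have L1ge1 v : e w v -> 1 <= mu (L1 v).
  move=> wv; rewrite /L1 mu_disjoint // ?muT'; last first.
    by move=> y [[Bv _] /TC [Bw _]]; apply: stg wv Bw Bv.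
  rewrite /L1' mu_diff ?muB ?muBA; [|by case: (mB v)|by case: mA].
  have kk : k * (1 / k) = 1 by field; lra.
  have : 0 < 1 / k by lra.
  by move: kk; set z := 1 / k => kz z0; nra.
exists (fun i => match i with O => fun=> A | 1%N => L1 | 2%N => L2 | _ => L3 end).
split=> //.
- by move=> v y [].
- have BO v y : B v y -> 0 <= y /\ y < k + eps by move=> [/OmI].
  have AO y : A y -> 0 <= y /\ y < k + eps by move/AOm/OmI.
  case=> [|[|[|[|]]]] // v _ [h0 h1]; apply: unit_refinement_exists => //.
  + by have := muA (fun=> True); rewrite andT -/(nu (fun=> True)) nuT; lra.
  + by move=> y [[/BO]|/TC [/BO]].
  + by apply: L1ge1; apply: h1.
  + by move=> y [[[/BO]]|[/SA /AO]].
  + by move=> y [/BO].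
(* The pairs of layers are 0-0, 0-1, 1-1, 1-2, 2-2 and 2-3. The first would be a loop. All sets of
   layer 1 share [T], so edges inside it are excluded by [no_triangle]. Elsewhere old types, new
   types, or the removal of [A], [S] and [T] separate the sets. *)
- case=> [|[|[|]]] // [|[|[|[|]]]] //= u v _ _ [u0 u1] [v0 v1] uv y.
  + by move: uv; rewrite (u0 erefl) (v0 erefl) eirr.
  + by move=> [Ay [[_]|/TC []]].
  + by case: (no_triangle k mu1 stq fX _ (u1 erefl) (v1 erefl) uv); lra.
  + move=> [[[Bu nA]|Ty] [[[Bv nS] nT]|[Sy _]]] //; [exact: stg uv Bu Bv | exact/nA/SA|].
    by case: (TC y Ty) => _; apply; apply: SA.
  + move=> [[[[Bu nS] nT]|Hu] [[[Bv nS'] nT']|Hv]].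
    * exact: stg uv Bu Bv.
    * by case: Hv.
    * by case: Hu.
    * exact: stH uv Hu Hv.
  + by move=> [[[[Bu nS] nT]|[Sy _]] [Bv nS']] //; apply: stg uv Bu Bv.
Qed.

(** * Walks from the precoloured vertices and gluing of the local recolourings *)

Definition walk_of_length (V : finType) (e : rel V) (i : nat) (w v : V) : bool :=
  [exists t : i.-tuple V, path e w t && (last w t == v)].

Lemma walk_of_lengthP (V : finType) (e : rel V) (i : nat) (w v : V) :
  reflect (exists t, [/\ path e w t, last w t = v & size t = i]) (walk_of_length e i w v).
Proof.
apply: (iffP existsP) => [[t /andP [pt /eqP lt]]|[t [pt lt st]]].
  by exists t; rewrite size_tuple.
by move/eqP: st => st; exists (Tuple st); rewrite /= pt lt eqxx.
Qed.

Lemma walk_layer_compatible (V : finType) (e : rel V) (i : nat) (w v : V) :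
  walk_of_length e i w v -> layer_compatible e w i v.
Proof.
move/walk_of_lengthP=> [t [pt lt st]]; split=> i0; move: st pt lt; rewrite i0.
  by move/size0nil => -> /=.
by case: t => [//|x [|//]] _ /= /andP [wx _] <-.
Qed.

Lemma walk_step (V : finType) (e : rel V) (i : nat) (w u v : V) :
  walk_of_length e i w u -> e u v -> walk_of_length e i.+1 w v.
Proof.
move/walk_of_lengthP=> [t [pt lt st]] uv; apply/walk_of_lengthP; exists (rcons t v).
by rewrite rcons_path last_rcons size_rcons pt lt uv st.
Qed.

Lemma walks_meet (V : finType) (e : rel V) (W : {set V}) (d i j : nat) (w w' v : V) :
  ssrbool.symmetric e -> pairwise_dist_ge e W d -> w \in W -> w' \in W ->
  walk_of_length e i w v -> walk_of_length e j w' v -> (i + j < d)%N -> w = w'.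
Proof.
move=> esym hW wW wW' /walk_of_lengthP [t [pt lt <-]] /walk_of_lengthP [t' [pt' lt' <-]].
rewrite ltnNge => /negP nd; apply/eqP/negP => /negP ww'; apply: nd.
(* The first walk is followed by the reverse of the second; [belast] omits the common end [v], so
   the length is [i + j]. *)
have := hW _ _ wW wW' ww' (t ++ rev (belast w' t')).
rewrite size_cat size_rev size_belast; apply.
  rewrite cat_path pt lt -lt' rev_path.
  by rewrite (eq_path (e' := e)) // => x y; rewrite esym.
rewrite last_cat lt -lt'; case: t' {pt' lt'} => [//|x t'] /=.
by rewrite rev_cons last_rcons.
Qed.

(** The label is a nearest vertex of [W] with its distance. The value 4 stands for every distance
    above three, so a minimum exists even when no vertex of [W] is reachable. *)
Lemma layer_exists (V : finType) (e : rel V) (W : {set V}) (v : V) :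
  exists wi : V * nat, [/\ (wi.2 <= 4)%N,
    (wi.2 <= 3)%N -> wi.1 \in W /\ walk_of_length e wi.2 wi.1 v
    & forall w j, w \in W -> walk_of_length e j w v -> (wi.2 <= j)%N].
Proof.
pose P i := [exists w in W, walk_of_length e i w v] || (i == 4%N).
have exP : exists i, P i by exists 4%N; rewrite /P orbT.
have mP w j : w \in W -> walk_of_length e j w v -> P j.
  by move=> wW wv; apply/orP; left; apply/existsP; exists w; rewrite wW.
case: (ex_minnP exP) => m Pm minm.
have m4 : (m <= 4)%N by apply: minm; rewrite /P orbT.
case/orP: Pm => [/existsP [w /andP [wW wv]]|/eqP m4'].
  by exists (w, m); split=> // w' j wW' /(mP _ _ wW') /minm.
by exists (v, m); split=> //= [|w' j wW' /(mP _ _ wW') /minm//]; rewrite m4'.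
Qed.

Lemma choice_fun (A B : Type) (P : A -> B -> Prop) :
  (forall x, exists y, P x y) -> exists f : A -> B, forall x, P x (f x).
Proof.
move=> h; exists (fun x => proj1_sig (constructive_indefinite_description _ (h x))) => x.
exact: proj2_sig.
Qed.

(** Each vertex takes its set from the recolouring around its nearest vertex of [W], or from [B] if
    that vertex is farther than three, and is then cut down to measure one. *)
Lemma glue_recolorings (V : finType) (e : rel V) (p : R) (W : {set V})
    (c B : V -> R -> Prop) :
  ssrbool.symmetric e -> pairwise_dist_ge e W 7 ->
  (forall v, v \in W -> unit_subset p (c v)) ->
  (forall v, exists U, unit_refinement p (B v) U) ->
  (forall u v, e u v -> forall y, ~ (B u y /\ B v y)) ->
  (forall w, w \in W -> exists L, recoloring e p w (c w) B L) ->
  precoloring_extends e W p c.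
Proof.
move=> esym hW hc uB dB hL.
have [lab hlab] := choice_fun (layer_exists e W).
have /choice_fun [L {}hL] : forall w, exists L, w \in W -> recoloring e p w (c w) B L.
  move=> w; case: (boolP (w \in W)) => [/hL [L HL]|nw]; first by exists L.
  (* A dummy value for vertices outside [W]. *)
  by exists (fun _ _ _ => True).
pose P v := if ((lab v).2 <= 3)%N then L (lab v).1 (lab v).2 v else B v.
have /choice_fun [c' hc'] : forall v, exists U, unit_refinement p (P v) U.
  move=> v; rewrite /P; have [_ + _] := hlab v; case: leqP => // i3 /(_ isT) [wW wv].
  exact (recoloring_unit (hL _ wW) i3 (walk_layer_compatible wv)).
have PB v y : (3 <= (lab v).2)%N -> P v y -> B v y.
  rewrite /P => i3; have [_ + _] := hlab v; case: leqP => // i3' /(_ isT) [wW wv].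
  have -> : (lab v).2 = 3%N by apply/eqP; rewrite eqn_leq i3 i3'.
  exact: (recoloring3 (hL _ wW) (v := v)).
have dP u v y : e u v -> ((lab u).2 <= (lab v).2)%N -> ~ (P u y /\ P v y).
  move=> uv ij; case: (leqP 3 (lab u).2) => [i3 [Pu Pv]|i2].
    (* With both labels at least three, both sets lie in the unmodified sets [B]. *)
    exact: dB uv y (conj (PB u y i3 Pu) (PB v y (leq_trans i3 ij) Pv)).
  have [_ hu _] := hlab u; have [_ hv hvmin] := hlab v.
  have [wW wu] := hu (ltnW i2); have wv := walk_step wu uv.
  have ji := hvmin _ _ wW wv; have j3 := leq_trans ji i2.
  (* Both centres reach [v] in at most three steps, since [(lab u).2 + 1 <= 3] and [(lab v).2 <= 3].
     The total is below seven, so the centres coincide. *)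
  have [wW' wv'] := hv j3; have ww' : (lab v).1 = (lab u).1.
    apply: walks_meet esym hW wW' wW wv' wv _; rewrite ltnS.
    exact: leq_add j3 i2.
  rewrite /P (ltnW i2) j3; move: wv'; rewrite ww' => wv'.
  have ijS : ((lab u).2 <= (lab v).2 <= (lab u).2.+1)%N by rewrite ij ji.
  have := recoloring_disjoint (hL _ wW) i2 ijS (walk_layer_compatible wu).
  by apply; [apply: walk_layer_compatible wv' |].
exists c'; split; first split.
- by move=> v; case: (hc' v).
- move=> u v uv x [cu cv]; have [_ /(_ x cu) Pu _] := hc' u; have [_ /(_ x cv) Pv _] := hc' v.
  case: (leqP (lab u).2 (lab v).2) => [ij|/ltnW ij]; first exact: dP uv ij (conj Pu Pv).
  by rewrite esym in uv; apply: dP uv ij (conj Pv Pu).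
(* A vertex of [W] has label 0 and is its own centre, so [P v] is [c v], already of measure one and
   left unchanged by the last clause of [unit_refinement]. *)
move=> v vW x; have [_ hv hvmin] := hlab v; have [_ _ cP] := hc' v.
have i0 : (lab v).2 = 0%N.
  apply/eqP; rewrite -leqn0; apply: hvmin vW _.
  by apply/walk_of_lengthP; exists [::].
have [] := hv _; first by rewrite i0.
move=> wW /walk_layer_compatible [/(_ i0) vw _].
have Pc : P v = c v by rewrite /P i0 /= (recoloring0 (hL _ wW)) -vw.
by rewrite cP Pc //; apply: hc.
Qed.

(** * Types of colours and assembly of the extension *)

Definition members (V : finType) (c : V -> R -> Prop) (y : R) : {set V} :=
  [set v | if excluded_middle_informative (c v y) then true else false].

Lemma in_members (V : finType) (c : V -> R -> Prop) (y : R) (v : V) :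
  v \in members c y <-> c v y.
Proof. by rewrite inE; case: (excluded_middle_informative (c v y)). Qed.

Lemma fibred_members (V : finType) (Q : R -> Prop) (c : V -> R -> Prop) :
  bmeas Q -> (forall v, lebesgue_measurable (c v)) -> fibred Q (members c).
Proof.
move=> mQ mc; split=> F; apply: bmeas_and mQ _.
apply: (@measurable_determined V (enum V) c) => [v _|x y xy]; first exact: mc.
have -> // : members c x = members c y.
apply/setP => v; have := xy v; rewrite mem_enum => /(_ isT) {}xy.
by apply/idP/idP => /in_members ?; apply/in_members; tauto.
Qed.

Theorem mainTheorem19 (k : Q) (eps : R)
  (hk0 : (0 < Q2R k)%R) (hk3 : (Q2R k < 3)%R)
  (heps0 : (0 < eps)%R) (heps : (1 / (Q2R k + 1) <= eps)%R)
  (V : finType) (e : rel V) (hG : simple_graph e)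
  (hcol : frac_colorable e (Q2R k))
  (W : {set V}) (hW : pairwise_dist_ge e W 7)
  (c : V -> R -> Prop) (hc : frac_precoloring W (Q2R k + eps) c) :
  precoloring_extends e W (Q2R k + eps) c.
Proof.
move: (Q2R k) hk0 hk3 heps hcol hc => {k} r r0 r3 heps [c0 [hc0 dc0]] hc.
have [esym eirr] := hG.
pose X x := (0 <= x)%R /\ (x < r)%R; pose Om y := (0 <= y)%R /\ (y < r + eps)%R.
have mX : bmeas X := bmeas_itv 0 r.
have mOm : bmeas Om := bmeas_itv 0 (r + eps).
have muX : mu X = r by apply: mu_itv; lra.
have muOm : mu Om = (r + eps)%R by apply: mu_itv; lra.
have fX : fibred X (members c0).
  by apply: fibred_members => // v; case: (hc0 v) => _ [].
have c0X v : (fun x => X x /\ v \in members c0 x) = c0 v.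
  apply: set_ext => x; have := in_members c0 x v; have [sub _ _] := (unit_subsetP _ _).1 (hc0 v).
  by have := sub x; rewrite /X; tauto.
have mu1 v : mu (fun x => X x /\ v \in members c0 x) = 1%R.
  by rewrite c0X; case: ((unit_subsetP _ _).1 (hc0 v)).
(* The bound is stated relative to a vertex because [V] may be empty. *)
have r1 (v : V) : (1 <= r)%R.
  by rewrite -(mu1 v) -muX; apply: mu_mono; [case: mX | move=> x []].
have stq x u v : e u v -> u \in members c0 x -> v \in members c0 x -> False.
  by move=> uv /in_members cu /in_members cv; apply: (dc0 u v uv x).
(* Cutting down to [W] makes these sets measurable at every vertex, as nothing is known of [c v]
   outside [W]. *)
pose cW v y := v \in W /\ c v y.
have fJ : fibred Om (members cW).
  apply: fibred_members => // v; case: (boolP (v \in W)) => vW.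
    by apply: measurable_and; [exact: measurable_const | case: (hc v vW) => _ []].
  have -> : cW v = (fun=> False) by apply: set_ext => y; rewrite /cW (negbTE vW); split=> [[]|].
  exact: measurable_const.
(* [members cW] records all precoloured sets at once, so the new types [g] are independent of each
   of them. *)
have [|g [gq hg]] := independent_copy fX _ fJ; first by lra.
have OmT : (fun y => Om y /\ True) = Om by apply: set_ext => y; tauto.
have hOm F : bmeas (fun y => Om y /\ F (g y)) /\
    mu (fun y => Om y /\ F (g y)) = ((r + eps) * (mu (fun x => X x /\ F (members c0 x)) / r))%R.
  have -> : (fun y => Om y /\ F (g y)) = (fun y => (Om y /\ True) /\ F (g y)).
    by apply: set_ext => y; tauto.
  by have [mF ->] := hg (fun=> True) F; rewrite OmT muOm muX.
have cWE w : w \in W -> c w = (fun y => Om y /\ w \in members cW y).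
  move=> wW; have [sub _ _] := (unit_subsetP _ _).1 (hc w wW).
  by apply: set_ext => y; have := sub y; have := in_members cW y w; rewrite /cW /Om; tauto.
have hA w F : w \in W -> bmeas (fun y => c w y /\ F (g y)) /\
    mu (fun y => c w y /\ F (g y)) = (mu (fun x => X x /\ F (members c0 x)) / r)%R.
  move=> wW; have [_ _ mu_c] := (unit_subsetP _ _).1 (hc w wW).
  move: mu_c; rewrite (cWE w wW) => mu_c.
  by have [mF ->] := hg (fun t => w \in t) F; rewrite mu_c muX; split=> //; lra.
apply: (glue_recolorings (B := fun v y => Om y /\ v \in g y)) => //.
- move=> v; apply: unit_refinement_exists; first by move=> y [].
    exact: (hOm (fun t => v \in t)).1.
  rewrite (hOm (fun t => v \in t)).2 mu1.
  have rV : (0 < 1 / r)%R by apply: Rdiv_lt_0_compat; lra.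
  have rr : (r * (1 / r) = 1)%R by field; lra.
  by nra.
- move=> u v uv y [[_ +] [_]]; have [x ->] := gq y; exact: stq uv.
move=> w wW; apply: (@recoloring_exists V e r eps X Om (c w) (members c0) g w) => //.
- exact: r1 w.
- by move=> y; rewrite (cWE w wW) => -[].
- by split=> F; case: (hOm F).
- by split=> F; case: (hA w F wW).
- by move=> F; case: (hOm F).
- by move=> F; case: (hA w F wW).
Qed.
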